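(* There is an explicit construction $\mathcal R$ (a rule whose only inputs are finite sets $X'\subset\mathbb{R}^n$ and $Y'\subset\mathbb{R}^m$, real numbers $\epsilon_{\mathcal X},\epsilon_{\mathcal Y},\kappa$, and a map $f':X'\to\mathbb{R}^m$, and whose output, when defined, is a simplicial map $N(X')\to N(Y')$) for which the following holds. Let $\mathcal X\subset\mathbb{R}^n$ and $\mathcal Y\subset\mathbb{R}^m$ be compact Riemannian submanifolds with condition numbers $1/\tau_{\mathcal X}$ and $1/\tau_{\mathcal Y}$, and let $\delta_{\mathcal X},\delta_{\mathcal Y}\in(0,1]$. Let $f:\mathcal X\to\mathcal Y$ be Lipschitz continuous with Lipschitz constant bounded above by some $\kappa\ge0$ satisfying $4\kappa\,\tau_{\mathcal X}<(\sqrt2-1)\tau_{\mathcal Y}$. For $\mathcal Z\in\{\mathcal X,\mathcal Y\}$ let $0<r_{\mathcal Z}<(3-\sqrt8)\tau_{\mathcal Z}$ and let $\mu_{\mathcal Z}$ be an $r_{\mathcal Z}$-conditioned probability measure about $\mathcal Z$. Let $\epsilon_{\mathcal X},\epsilon_{\mathcal Y}$ satisfy $\Gamma^-_{\mathcal Z}(r_{\mathcal Z})<\epsilon_{\mathcal Z}<\Gamma^+_{\mathcal Z}(r_{\mathcal Z})$ for $\mathcal Z\in\{\mathcal X,\mathcal Y\}$ and $$4\kappa(\epsilon_{\mathcal X}+r_{\mathcal X})<\epsilon_{\mathcal Y}-r_{\mathcal Y}.$$ Let $X'\subset\mathbb{R}^n$ and $Y'\subset\mathbb{R}^m$ be finite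 sets obtained by i.i.d. sampling with respect to $\mu_{\mathcal X}$ and $\mu_{\mathcal Y}$ respectively, the two samples being independent of each other, with $\#X'>\gamma_{\mathcal X}(\mu_{\mathcal X},\delta_{\mathcal X})$ and $\#Y'>\gamma_{\mathcal Y}(\mu_{\mathcal Y},\delta_{\mathcal Y})$. Let $f':X'\to\mathbb{R}^m$ satisfy $\|f'(\xi)-f\circ\pi_{\mathcal X}(\xi)\|\le d$ for each $\xi\in X'$, where $d>0$ satisfies $$d<\frac{(\epsilon_{\mathcal Y}-r_{\mathcal Y})-2\kappa(\epsilon_{\mathcal X}+r_{\mathcal X})}{2}.$$ Then, with probability exceeding $(1-\delta_{\mathcal X})(1-\delta_{\mathcal Y})$, the construction $\mathcal R$ applied to $(X',Y',\epsilon_{\mathcal X},\epsilon_{\mathcal Y},\kappa,f')$ yields a simplicial map $\phi:N(X')\to N(Y')$ which is a simplicial reconstruction of $f$.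
   Context: Condition number: for a compact Riemannian submanifold $\mathcal X\subset\mathbb{R}^n$, $\tau_{\mathcal X}$ is the largest positive real number such that for every $r\in(0,\tau_{\mathcal X})$ the normal bundle of radius $r$ about $\mathcal X$ is embedded in $\mathbb{R}^n$ (by $(x,v)\mapsto x+v$); the condition number is $1/\tau_{\mathcal X}$. $\mathcal B_s(p)$ is the open Euclidean ball of radius $s$ about $p$. Nearest point projection: $\pi_{\mathcal X}(w)=\arg\min_{x\in\mathcal X}\|w-x\|$. Conditioned measure: for $P\subset\mathbb{R}^n$ and $r>0$, a probability measure $\mu$ on $\mathbb{R}^n$ is $r$-conditioned about $P$ if (1) its support is contained in $\mathrm{Tub}_r(P)=\{x\in\mathbb{R}^n:\exists p\in P,\ \|p-x\|<r\}$, and (2) for each $s\in(0,r)$, $\Omega_s:=\inf_{p\in P}\mu(\mathcal B_s(p))>0$. Write $\Omega(\mu)=\Omega_{r/2}$. For $0<r<(3-\sqrt8)\tau_{\mathcal X}$, $\Gamma^{\pm}_{\mathcal X}(r)=\frac{(\tau_{\mathcal X}+r)\pm\sqrt{\tau_{\mathcal X}^2+r^2-6\tau_{\mathcal X}r}}{2}$. The $\nu$-covering number $\Lambda_\nu(\mathcal X)$ is the minimum $q\in\mathbb{N}$ such that some finite $S\subset\mathcal X$ of cardinality $q$ has $\mathcal X\subset\bigcup_{s\in S}\mathcal B_\nu(s)$. For an $r$-conditioned probability measure $\mu$ about $\mathcal X$ and $\delta\in(0,1]$, $$\gamma_{\mathcal X}(\mu,\delta)=\frac1{\Omega(\mu)}\left(\log\Lambda_{r/2}(\mathcal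 X)+\log(1/\delta)\right).$$ The quantities for $\mathcal Y$ are defined likewise. $N(X')$ is the nerve of the collection of open balls of radius $\epsilon_{\mathcal X}$ about points of $X'$ (simplices are nonempty subcollections with nonempty common intersection), and $\mathcal U(X')$ is the union of these balls; $N(Y')$ and $\mathcal U(Y')$ are defined likewise with radius $\epsilon_{\mathcal Y}$. For a simplex $\sigma$ of either nerve, $\lceil\sigma\rceil$ is the union of the balls that are its vertices. A simplicial map $\phi:N(X')\to N(Y')$ is a simplicial reconstruction of $f$ if $g(\lceil\sigma\rceil)\subset\lceil\phi(\sigma)\rceil$ for each $\sigma\in N(X')$, where $g=\iota_{\mathcal Y}\circ f\circ\pi_{\mathcal X}:\mathcal U(X')\to\mathcal U(Y')$ and $\iota_{\mathcal Y}:\mathcal Y\to\mathcal U(Y')$ is the inclusion (i.e. $g$ is $f\circ\pi_{\mathcal X}$ with values regarded in $\mathbb{R}^m$). *)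

(* Defs.v *)
From HB Require Import structures.
From mathcomp Require Import all_boot all_order all_algebra.
From mathcomp Require Import finmap.
From mathcomp Require Import all_classical all_reals all_analysis.

Set Implicit Arguments.
Unset Strict Implicit.
Unset Printing Implicit Defensive.

Import Order.TTheory GRing.Theory Num.Theory.
Import numFieldNormedType.Exports.

Local Open Scope classical_set_scope.
Local Open Scope ring_scope.

(* The library norm on ['rV[R]_n] is the sup norm: it gives the usual topology,
   smooth structure and Borel sets, but all metric notions below have to use
   the Euclidean norm [enorm]. *)
Definition edot (R : realType) (n : nat) (x y : 'rV[R]_n) : R :=
  \sum_(i < n) x 0 i * y 0 i.

Definition enorm (R : realType) (n : nat) (x : 'rV[R]_n) : R :=
  Num.sqrt (edot x x).

Definition eball (R : realType) (n : nat) (p : 'rV[R]_n) (s : R) :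
    set 'rV[R]_n :=
  [set x | enorm (x - p) < s].

Definition tub (R : realType) (n : nat) (r : R) (A : set 'rV[R]_n) :
    set 'rV[R]_n :=
  [set x | exists2 p, A p & enorm (p - x) < r].

Definition lipschitz_bound (R : realType) (n m : nat) (A : set 'rV[R]_n)
    (f : 'rV[R]_n -> 'rV[R]_m) (kappa : R) : Prop :=
  forall x y, A x -> A y -> enorm (f x - f y) <= kappa * enorm (x - y).

(* To be used with [U] open and [V] finite-dimensional, where having continuous
   iterated directional derivatives up to order [k] is being of class C^k. *)
Fixpoint C_k (R : realType) (V W : normedModType R) (k : nat) (U : set V)
    (F : V -> W) : Prop :=
  (forall x, U x -> {for x, continuous F}) /\
  match k with
  | 0%N => True
  | k'.+1 => forall v, (forall x, U x -> derivable F x v) /\ C_k k' U ('D_v F)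
  end.

Definition smooth_on (R : realType) (V W : normedModType R) (U : set V)
    (F : V -> W) : Prop :=
  forall k, C_k k U F.

(* Embedded, without boundary: near each of its points, [X] is straightened by
   an ambient diffeomorphism onto the span of the first [k] coordinates. *)
Definition submanifold (R : realType) (n k : nat) (X : set 'rV[R]_n) : Prop :=
  forall p, X p ->
  exists (U V : set 'rV[R]_n) (Phi Psi : 'rV[R]_n -> 'rV[R]_n),
    [/\ [/\ open U, open V & U p],
        smooth_on U Phi /\ smooth_on V Psi,
        (forall x, U x -> V (Phi x) /\ Psi (Phi x) = x),
        (forall y, V y -> U (Psi y) /\ Phi (Psi y) = y) &
        (forall x, U x ->
           X x <-> forall i : 'I_n, (k <= i)%N -> Phi x 0 i = 0)].

Definition compact_submanifold (R : realType) (n : nat) (X : set 'rV[R]_n) :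
    Prop :=
  compact X /\ exists2 k, (k <= n)%N & submanifold k X.

Definition tangent (R : realType) (V : normedModType R) (S : set V) (p : V) :
    set V :=
  [set w | exists (c : R^o -> V) (e : R),
    [/\ 0 < e, smooth_on [set t : R^o | `|t| < e] c,
        (forall t, `|t| < e -> S (c t)), c 0 = p & 'D_1 c 0 = w]].

(* For [S] an embedded submanifold of [V] and [F] an ambient map:
   the restriction of [F] to [S] is an injective immersion which is a
   homeomorphism onto its image. *)
Definition smooth_embedding (R : realType) (V W : normedModType R) (S : set V)
    (F : V -> W) : Prop :=
  [/\ exists O : set V, [/\ open O, S `<=` O & smooth_on O F],
      {in S &, injective F},
      (forall p w, S p -> tangent S p w -> 'D_w F p = 0 -> w = 0) &
      exists2 G : W -> V, {within F @` S, continuous G} &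
        forall p, S p -> G (F p) = p].

Definition normal_bundle (R : realType) (n : nat) (X : set 'rV[R]_n) (r : R) :
    set ('rV[R]_n * 'rV[R]_n) :=
  [set p | [/\ X p.1, (forall w, tangent X p.1 w -> edot p.2 w = 0) &
               enorm p.2 < r]].

Definition normal_bundle_embedded (R : realType) (n : nat)
    (X : set 'rV[R]_n) (r : R) : Prop :=
  smooth_embedding (normal_bundle X r)
    (fun p : 'rV[R]_n * 'rV[R]_n => p.1 + p.2).

Definition embedded_below (R : realType) (n : nat) (X : set 'rV[R]_n)
    (tau : R) : Prop :=
  forall r, 0 < r -> r < tau -> normal_bundle_embedded X r.

(* [X] has condition number [1 / tau]. *)
Definition is_tau (R : realType) (n : nat) (X : set 'rV[R]_n) (tau : R) :
    Prop :=
  [/\ 0 < tau, embedded_below X tau &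
      forall t, 0 < t -> embedded_below X t -> t <= tau].

Definition is_nearest (R : realType) (n : nat) (X : set 'rV[R]_n)
    (w x : 'rV[R]_n) : Prop :=
  X x /\ forall y, X y -> enorm (w - x) <= enorm (w - y).

(* Arbitrary where the minimizer is not unique. *)
Definition nearest_proj (R : realType) (n : nat) (X : set 'rV[R]_n)
    (w : 'rV[R]_n) : 'rV[R]_n :=
  get [set x | is_nearest X w x].

Definition Gamma_minus (R : realType) (tau r : R) : R :=
  ((tau + r) - Num.sqrt (tau ^+ 2 + r ^+ 2 - 6 * tau * r)) / 2.

Definition Gamma_plus (R : realType) (tau r : R) : R :=
  ((tau + r) + Num.sqrt (tau ^+ 2 + r ^+ 2 - 6 * tau * r)) / 2.

Definition borelRn (R : realType) (n : nat) :=
  g_sigma_algebraType (@open 'rV[R]_n).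

Definition support_of (R : realType) (n : nat)
    (mu : probability (borelRn R n) R) : set 'rV[R]_n :=
  [set x | forall U : set 'rV[R]_n, open U -> U x -> (0 < mu U)%E].

Definition Omega (R : realType) (n : nat) (mu : probability (borelRn R n) R)
    (P : set 'rV[R]_n) (s : R) : \bar R :=
  ereal_inf [set mu (eball p s) | p in P].

Definition conditioned (R : realType) (n : nat) (P : set 'rV[R]_n) (r : R)
    (mu : probability (borelRn R n) R) : Prop :=
  support_of mu `<=` tub r P /\
  forall s, 0 < s -> s < r -> (0 < Omega mu P s)%E.

Definition covered_by (R : realType) (n : nat) (X : set 'rV[R]_n) (nu : R)
    (q : nat) : Prop :=
  exists S : {fset 'rV[R]_n},
    [/\ #|` S|%fset = q, [set` S] `<=` X &
        X `<=` \bigcup_(s in [set` S]) eball s nu].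

(* [0] if no finite cover exists, which does not happen for [X] compact and
   [nu > 0]. *)
Definition covering_number (R : realType) (n : nat) (X : set 'rV[R]_n)
    (nu : R) : nat :=
  if pselect (exists q, `[< covered_by X nu q >]) is left exq then ex_minn exq
  else 0%N.

Definition gamma (R : realType) (n : nat) (X : set 'rV[R]_n) (r : R)
    (mu : probability (borelRn R n) R) (delta : R) : R :=
  (fine (Omega mu X (r / 2)))^-1 *
  (ln (covering_number X (r / 2))%:R + ln (1 / delta)).

Definition ball_union (R : realType) (n : nat) (e : R) (S : {fset 'rV[R]_n}) :
    set 'rV[R]_n :=
  \bigcup_(x in [set` S]) eball x e.

(* Vertices of the nerve are identified with the centers of the balls. *)
Definition nerve (R : realType) (n : nat) (e : R) (S : {fset 'rV[R]_n}) :
    set {set S} :=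
  [set s | s != finset.set0 /\
           \bigcap_(x in [set` s]) eball (val x) e !=set0].

Definition simplex_union (R : realType) (n : nat) (e : R)
    (S : {fset 'rV[R]_n}) (s : {set S}) : set 'rV[R]_n :=
  \bigcup_(x in [set` s]) eball (val x) e.

Record simplicial_map (R : realType) (n m : nat) (eX : R)
    (X' : {fset 'rV[R]_n}) (eY : R) (Y' : {fset 'rV[R]_m}) := SimplicialMap {
  vertex_map :> X' -> Y';
  vertex_map_simplicial : forall s : {set X'},
    nerve eX s -> nerve eY [set vertex_map x | x in s]%SET }.

(* The first two clauses say that [f \o nearest_proj X] is a well-defined map
   from the union of the balls about [X'] to the union of those about [Y']. *)
Definition simplicial_reconstruction (R : realType) (n m : nat)
    (X : set 'rV[R]_n) (Y : set 'rV[R]_m) (f : 'rV[R]_n -> 'rV[R]_m)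
    (eX : R) (X' : {fset 'rV[R]_n}) (eY : R) (Y' : {fset 'rV[R]_m})
    (phi : simplicial_map eX X' eY Y') : Prop :=
  [/\ (forall w, ball_union eX X' w -> exists! x, is_nearest X w x),
      Y `<=` ball_union eY Y' &
      forall s : {set X'}, nerve eX s ->
        (f \o nearest_proj X) @` simplex_union eX s `<=`
        simplex_union eY [set phi x | x in s]%SET].

Definition reconstruction_rule (R : realType) : Type :=
  forall (n m : nat) (X' : {fset 'rV[R]_n}) (Y' : {fset 'rV[R]_m})
    (eX eY kappa : R) (f' : X' -> 'rV[R]_m),
  option (simplicial_map eX X' eY Y').

(* As [F i] ranges over sigma-algebras, which contain [setT], the product rule
   over all of [I] includes the one over each subfamily. *)
Definition independent_sigma_algebras (R : realType) (d : measure_display)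
    (T : measurableType d) (P : probability T R) (I : finType)
    (F : I -> set (set T)) : Prop :=
  forall A : I -> set T, (forall i, F i (A i)) ->
    P (\bigcap_i A i) = (\prod_(i : I) P (A i))%E.

Definition sigma_of (d d' : measure_display) (T : measurableType d)
    (T' : measurableType d') (X : T -> T') : set (set T) :=
  preimage_set_system setT X measurable.

(* Two samples of sizes [N] and [M] drawn from [mu] and [nu]: each i.i.d., and
   independent of each other. *)
Definition independent_iid_samples (R : realType) (n m : nat)
    (d : measure_display) (T : measurableType d) (P : probability T R)
    (mu : probability (borelRn R n) R) (nu : probability (borelRn R m) R)
    (N M : nat) (xi : 'I_N -> {RV P >-> borelRn R n})
    (eta : 'I_M -> {RV P >-> borelRn R m}) : Prop :=
  [/\ (forall i A, measurable A -> distribution P (xi i) A = mu A),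
      (forall j B, measurable B -> distribution P (eta j) B = nu B) &
      independent_sigma_algebras P
        (fun k : 'I_N + 'I_M =>
           match k with
           | inl i => sigma_of (xi i)
           | inr j => sigma_of (eta j)
           end)].

Definition sample_set (R : realType) (n : nat) (d : measure_display)
    (T : measurableType d) (P : probability T R) (N : nat)
    (xi : 'I_N -> {RV P >-> borelRn R n}) (w : T) : {fset 'rV[R]_n} :=
  [fset (xi i w : 'rV[R]_n) | i in 'I_N]%fset.

(* Main.v *)
Require Import Defs.
From HB Require Import structures.
From mathcomp Require Import all_boot all_order all_algebra.
From mathcomp Require Import finmap.
From mathcomp Require Import all_classical all_reals all_analysis.
From mathcomp Require Import ring lra.

Set Implicit Arguments.
Unset Strict Implicit.
Unset Printing Implicit Defensive.

Import Order.TTheory GRing.Theory Num.Theory.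
Import numFieldNormedType.Exports.

Local Open Scope classical_set_scope.
Local Open Scope ring_scope.

(** Send each sample point [x] to a point of [Y'] nearest to [f' x]. If every
    point of [Y] is within [rY] of [Y'], then [f' x], which is within [dist] of
    [f (pi x)], is within [rY + dist] of its chosen vertex [phi x]. If moreover
    [x] is in the [rX]-tube of [X] and [w] is in the [eX]-ball about [x], then
    [pi x] and [pi w] are at distance at most [2 * (eX + rX)], by three triangle
    inequalities, so that [f (pi w)] is within
    [rY + 2 * dist + 2 * kappa * (eX + rX) < eY] of [phi x]. Hence the map
    [f \o pi] sends the ball about [x] into the ball about [phi x]
    ([nearest_vertex_map_eball]); applied to a common point of the balls of a
    simplex this shows that [phi] is simplicial, and applied to all their points
    that it reconstructs [f] ([nearest_vertex_rule_reconstructs]).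

    The projection [pi] is well defined on the balls because
    [eX < Gamma_plus tauX rX] gives [eX + rX < tauX] ([Gamma_plus_lt]), and a
    point at distance less than [tauX] from [X] has one nearest point only: the
    displacement from a nearest point is normal to [X] by the first-derivative
    test, so two nearest points would give two elements of the normal bundle with
    the same image under the embedding [(x, v) |-> x + v] ([is_nearest_unique]).

    It remains to bound the probability of the favourable samples ([good_event]).
    Almost surely the first sample stays in the tube, because the complement of
    the tube is a sigma-compact set covered by open null sets. Cover [Y] by [L]
    balls of radius [rY / 2], with [L] the covering number; if each of them
    contains a point of the second sample then every point of [Y] is within [rY]
    of that sample. By independence a given ball is missed with probability at
    most [(1 - q) ^+ M <= expR (- (q * M%:R))], where [q] is the infimum of the
    measures of such balls, and [M > gamma Y rY muY deltaY] says that [L] times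
    this is less than [deltaY] ([gamma_tail]). So the favourable event has
    probability above [1 - deltaY >= (1 - deltaX) * (1 - deltaY)]. *)

(** * The Euclidean norm *)

Section EuclideanNorm.
Variables (R : realType) (n : nat).
Implicit Types x y z : 'rV[R]_n.

Lemma edotC x y : edot x y = edot y x.
Proof. by apply: eq_bigr => i _; rewrite mulrC. Qed.

Lemma edotDl x y z : edot (x + y) z = edot x z + edot y z.
Proof.
by rewrite /edot -big_split; apply: eq_bigr => i _; rewrite mxE mulrDl.
Qed.

Lemma edotZl a x y : edot (a *: x) y = a * edot x y.
Proof. by rewrite /edot mulr_sumr; apply: eq_bigr => i _; rewrite mxE mulrA. Qed.

Lemma edotDr x y z : edot x (y + z) = edot x y + edot x z.
Proof. by rewrite edotC edotDl !(edotC x). Qed.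

Lemma edotZr a x y : edot x (a *: y) = a * edot x y.
Proof. by rewrite edotC edotZl edotC. Qed.

Lemma edot_ge0 x : 0 <= edot x x.
Proof. by apply: sumr_ge0 => i _; rewrite -expr2 sqr_ge0. Qed.

Lemma edot_eq0 x : edot x x = 0 -> x = 0.
Proof.
move=> /eqP; rewrite psumr_eq0; last by move=> i _; rewrite -expr2 sqr_ge0.
move=> /allP x0; apply/rowP => i; apply/eqP; rewrite mxE -sqrf_eq0 expr2.
exact: (implyP (x0 i (mem_index_enum i))).
Qed.

(** For [y != 0] this is the nonnegativity of the squared norm of
    [edot y y *: x - edot x y *: y], divided by [edot y y]. *)
Lemma edot_cauchy_schwarz x y : edot x y ^+ 2 <= edot x x * edot y y.
Proof.
have [y0|] := eqVneq (edot y y) 0.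
  by rewrite (edot_eq0 y0) -(scale0r 0) !edotZr !mul0r mulr0 expr0n.
have := edot_ge0 y; rewrite le_eqVlt eq_sym => /predU1P[->|y_gt0 _].
  by rewrite eqxx.
have := edot_ge0 (edot y y *: x + (- edot x y) *: y).
rewrite !(edotDl, edotDr, edotZl, edotZr) (edotC y x) => h.
rewrite -subr_ge0 -(pmulr_rge0 _ y_gt0); apply: le_trans h _.
by rewrite le_eqVlt; apply/orP; left; apply/eqP; ring.
Qed.

Lemma enorm_ge0 x : 0 <= enorm x.
Proof. exact: sqrtr_ge0. Qed.

Lemma enorm_sqr x : enorm x ^+ 2 = edot x x.
Proof. exact/sqr_sqrtr/edot_ge0. Qed.

Lemma enormN x : enorm (- x) = enorm x.
Proof. by rewrite /enorm -scaleN1r edotZl edotZr !mulN1r opprK. Qed.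

Lemma enorm_sym x y : enorm (x - y) = enorm (y - x).
Proof. by rewrite -enormN opprB. Qed.

Lemma enorm_triangle x y : enorm (x + y) <= enorm x + enorm y.
Proof.
rewrite -ler_sqr ?nnegrE ?addr_ge0 ?enorm_ge0//.
rewrite sqrrD !enorm_sqr edotDl !edotDr (edotC y x).
suff h : edot x y <= enorm x * enorm y by lra.
apply: le_trans (ler_norm _) _.
rewrite -ler_sqr ?nnegrE ?mulr_ge0 ?enorm_ge0//.
by rewrite real_normK ?num_real// exprMn !enorm_sqr edot_cauchy_schwarz.
Qed.

Lemma enorm_dist_triangle y x z : enorm (x - z) <= enorm (x - y) + enorm (y - z).
Proof. by rewrite -(subrKA y) enorm_triangle. Qed.

Lemma enorm_continuous : continuous (@enorm R n).
Proof.
have edot_continuous : continuous (fun x : 'rV[R]_n => edot x x).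
  apply: (@continuous_big _ _ +%R) => [|i _ x]; first exact: add_continuous.
  by apply: (@continuousM R _ (fun z => z 0 i) (fun z => z 0 i));
    exact: coord_continuous.
move=> x; apply: (@continuous_comp _ _ _ (fun x => edot x x) Num.sqrt).
  exact: edot_continuous.
exact: sqrt_continuous.
Qed.

Lemma enorm_dist_continuous x : continuous (fun z => enorm (z - x)).
Proof.
move=> z; apply: (@continuous_comp _ _ _ (fun z => z - x) (@enorm R n));
  last exact: enorm_continuous.
by apply: (@continuousB R _ _ id (cst x)) => //; exact: cst_continuous.
Qed.

Lemma open_eball x s : open (eball x s).
Proof.
rewrite (_ : eball x s = (fun z => enorm (z - x)) @^-1` [set t | t < s])//.
by apply: open_comp => [z _|]; [exact: enorm_dist_continuous|exact: open_lt].
Qed.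

Lemma open_tub s (A : set 'rV[R]_n) : open (tub s A).
Proof.
rewrite (_ : tub s A = \bigcup_(p in A) eball p s).
  by apply: bigcup_open => p _; exact: open_eball.
by apply/seteqP; split => x [p Ap h]; exists p; rewrite // /eball /= enorm_sym.
Qed.

End EuclideanNorm.

(** * Nearest points *)

Section NearestPoint.
Variables (R : realType) (n : nat) (X : set 'rV[R]_n).

Lemma is_nearest_exists w : compact X -> X !=set0 -> exists x, is_nearest X w x.
Proof.
move=> cX X0; have [] := @EVT_min_rV R n
    (fun z : 'rV[R]_n => enorm (z - w)) X X0 cX.
  exact/continuous_subspaceT/enorm_dist_continuous.
move=> x /set_mem Xx xmin; exists x; split=> // y Xy.
by rewrite !(enorm_sym w) xmin ?inE.
Qed.

(** Along a curve [c] in [X] through [x], the squared distance to [w] is minimal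
    at time 0, so its derivative there, [-2] times the scalar product of [w - x]
    with the velocity of [c], is zero. *)
Lemma is_nearest_normal w x v :
  is_nearest X w x -> tangent X x v -> edot (w - x) v = 0.
Proof.
move=> [Xx xmin] [c [e [e0 c_smooth cX c0 cv]]].
have cder t : `|t| < e -> derivable c t 1.
  by move=> te; have [_ /(_ 1)[/(_ t te)]] := c_smooth 1%N.
pose h i (t : R) := (w 0 i - c t 0 i) * (w 0 i - c t 0 i).
have hder t i : `|t| < e ->
    is_derive t (1 : R) (h i) (- 2 * ((w 0 i - c t 0 i) * ('D_1 c t) 0 i)).
  move=> te; have := cder t te => /derivable_mxP/(_ 0 i)/derivableP ci.
  have ci' : is_derive t (1 : R) (fun t => c t 0 i : R) (('D_1 c t) 0 i).
    by rewrite (derive_mx (cder t te)) mxE; exact: ci.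
  have hi : is_derive t (1 : R) (cst (w 0 i) - (fun t => c t 0 i : R))
      (0 - ('D_1 c t) 0 i) by exact: is_deriveB.
  have := is_deriveM hi hi.
  rewrite (_ : _ *: _ + _ = - 2 * ((w 0 i - c t 0 i) * ('D_1 c t) 0 i)) //.
  rewrite /GRing.scale /= !fctE; ring.
have dist_derive t : `|t| < e ->
    is_derive t (1 : R) (\sum_(i < n) h i)
      (\sum_(i < n) (- 2 * ((w 0 i - c t 0 i) * ('D_1 c t) 0 i))).
  by move=> te; apply: is_derive_sum => i; exact: hder.
have dist_min : is_derive 0 (1 : R) (\sum_(i < n) h i) 0.
  apply: (@derive1_at_min _ _ (- e) e).
  - lra.
  - by move=> t; rewrite in_itv /= -ltr_norml => /dist_derive [].
  - by rewrite in_itv /= oppr_lt0 e0.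
  - move=> t; rewrite in_itv /= -ltr_norml => te.
    have hE s : (\sum_(i < n) h i) s = enorm (w - c s) ^+ 2.
      by rewrite enorm_sqr fct_sumE; apply: eq_bigr => i _; rewrite !mxE.
    rewrite !hE ler_sqr ?nnegrE ?enorm_ge0 // c0.
    exact/xmin/cX.
have e00 : `|0 : R| < e by rewrite normr0.
have := dist_derive 0 e00; move=> [_ d1]; have [_ d2] := dist_min.
move: d1; rewrite d2 -mulr_sumr c0 cv => /esym/eqP.
rewrite mulf_eq0 oppr_eq0 pnatr_eq0 /= => /eqP d0.
by rewrite -d0; apply: eq_bigr => i _; rewrite !mxE.
Qed.

(** Both [(x, w - x)] and [(y, w - y)] are in the normal bundle of some radius
    below [tau], and the embedding of this bundle maps both of them to [w]. *)
Lemma is_nearest_unique tau w x y : is_tau X tau ->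
  is_nearest X w x -> is_nearest X w y -> enorm (w - x) < tau -> x = y.
Proof.
move=> [tau_gt0 emb _] wx wy wtau.
have xy : enorm (w - x) = enorm (w - y).
  by apply: le_anti; rewrite (wx.2 _ wy.1) (wy.2 _ wx.1).
(* Any radius strictly between the distance and [tau] would do. *)
pose r := (enorm (w - x) + tau) / 2.
have := enorm_ge0 (w - x) => wx0.
have r_gt0 : 0 < r by rewrite /r; lra.
have r_lt : r < tau by rewrite /r; lra.
have wr : enorm (w - x) < r by rewrite /r; lra.
have [_ inj _ _] := emb r r_gt0 r_lt.
have normalP z : is_nearest X w z -> enorm (w - z) < r ->
    (z, w - z) \in normal_bundle X r.
  move=> wz zr; rewrite inE; split=> //=; first by case: wz.
  by move=> v; exact: is_nearest_normal.
have yr : enorm (w - y) < r by rewrite -xy.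
have := inj _ _ (normalP x wx wr) (normalP y wy yr).
by rewrite /= !subrKC => /(_ erefl) [].
Qed.

Lemma nearest_projP w : compact X -> X !=set0 ->
  is_nearest X w (nearest_proj X w).
Proof.
move=> cX X0.
exact: (@getPex _ [set x | is_nearest X w x] (is_nearest_exists w cX X0)).
Qed.

Lemma nearest_proj_dist s w : compact X -> tub s X w ->
  enorm (w - nearest_proj X w) < s.
Proof.
move=> cX [p Xp pw]; have [_ /(_ p Xp)] := nearest_projP w cX (ex_intro _ p Xp).
by rewrite (enorm_sym w p) => /le_lt_trans; apply.
Qed.

Lemma tub_eball r e x w : tub r X x -> eball x e w -> tub (r + e) X w.
Proof.
move=> [p Xp px] xw; exists p => //.
apply: le_lt_trans (enorm_dist_triangle x _ _) _.
by apply: ltrD => //; rewrite enorm_sym.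
Qed.

(** Go from the projection of [x] to [x], then to [w], then to the projection of
    [w]: the steps are shorter than [r], [e] and [e + r]. *)
Lemma nearest_proj_eball r e x w : compact X -> tub r X x -> eball x e w ->
  enorm (nearest_proj X x - nearest_proj X w) <= 2 * (e + r).
Proof.
move=> cX rx xw.
have := nearest_proj_dist cX rx; rewrite enorm_sym => h1.
have := nearest_proj_dist cX (tub_eball rx xw) => h2.
have := enorm_dist_triangle x (nearest_proj X x) (nearest_proj X w).
have := enorm_dist_triangle w x (nearest_proj X w).
have h3 : enorm (x - w) < e by rewrite enorm_sym.
lra.
Qed.

End NearestPoint.

(** * The admissible radii *)

Section GammaBounds.
Variables (R : realType) (tau r : R).
Hypothesis r_bound : 0 < r < (3 - Num.sqrt 8) * tau.

Lemma sqrt8_ge : 8 / 3 <= Num.sqrt 8 :> R.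
Proof. by rewrite -ler_sqr ?nnegrE ?sqrtr_ge0 ?sqr_sqrtr //; lra. Qed.

(** Because [3 - Num.sqrt 8 <= 1 / 3]. *)
Lemma tau_gt3r : 3 * r < tau.
Proof.
have := sqrt8_ge; move: r_bound => /andP[r0 rtau] s8.
have s9 : Num.sqrt 8 < 3 :> R.
  by rewrite -ltr_sqr ?nnegrE ?sqrtr_ge0 ?sqr_sqrtr //; lra.
have tau0 : 0 < tau.
  by rewrite -(pmulr_rgt0 _ (_ : 0 < 3 - Num.sqrt 8)); lra.
have := ler_pM2r tau0 (8 / 3) (Num.sqrt 8); rewrite s8 => h.
have : 8 / 3 * tau <= Num.sqrt 8 * tau by rewrite h.
lra.
Qed.

Lemma Gamma_minus_ge0 : 0 <= Gamma_minus tau r.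
Proof.
have := tau_gt3r; move: r_bound => /andP[r0 _] tr.
rewrite /Gamma_minus divr_ge0 // subr_ge0.
have -> : tau + r = Num.sqrt ((tau + r) ^+ 2).
  by rewrite sqrtr_sqr ger0_norm //; lra.
by rewrite ler_wsqrtr //; nra.
Qed.

(** The square of [tau - 3 * r], which is positive, exceeds the discriminant
    [tau ^+ 2 + r ^+ 2 - 6 * tau * r] by [8 * r ^+ 2]. *)
Lemma Gamma_plus_lt : Gamma_plus tau r + r < tau.
Proof.
have := tau_gt3r; move: r_bound => /andP[r0 _] tr.
suff : Num.sqrt (tau ^+ 2 + r ^+ 2 - 6 * tau * r) < tau - 3 * r.
  by rewrite /Gamma_plus; lra.
have -> : tau - 3 * r = Num.sqrt ((tau - 3 * r) ^+ 2).
  by rewrite sqrtr_sqr ger0_norm //; lra.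
by rewrite ltr_sqrt; nra.
Qed.

End GammaBounds.

(** * The reconstruction rule *)

Section Reconstruction.
Variable R : realType.

Definition is_nearest_vertex_map (m : nat) (I : finType) (Y' : {fset 'rV[R]_m})
    (f' : I -> 'rV[R]_m) (phi : {ffun I -> Y'}) : bool :=
  [forall x, forall y : Y', enorm (f' x - val (phi x)) <= enorm (f' x - val y)].

(** A vertex map is searched among the finitely many ones that minimize all the
    distances to the [f' x]; the reconstruction argument is valid for each of
    them, whichever way ties are broken. *)
Definition nearest_vertex_rule : reconstruction_rule R :=
  fun n m X' Y' eX eY _ f' =>
  if [pick phi : {ffun X' -> Y'} | is_nearest_vertex_map f' phi] is Some phi
  then
    if pselect (forall s : {set X'}, nerve eX s ->
                nerve eY [set phi x | x in s]%SET) is left phi_simplicial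
    then Some (SimplicialMap phi_simplicial)
    else None
  else None.

Lemma nearest_vertex_map_exists (m : nat) (I : finType) (Y' : {fset 'rV[R]_m})
    (f' : I -> 'rV[R]_m) :
  (I -> inhabited Y') ->
  exists phi : {ffun I -> Y'}, is_nearest_vertex_map f' phi.
Proof.
move=> Y'0.
have /fin_all_exists[phi phiP] : forall x, exists y : Y',
    forall z : Y', enorm (f' x - val y) <= enorm (f' x - val z).
  move=> x; have [y0] := Y'0 x.
  case: (@arg_minP _ R _ y0 predT (fun y : Y' => enorm (f' x - val y))) => //.
  move=> y _ ymin.
  by exists y => z; exact: ymin.
exists [ffun x => phi x]; apply/forallP => x; apply/forallP => y.
by rewrite ffunE.
Qed.

(** The vertex [phi x] is at least as near to [f' x] as the point of [Y'] that
    is within [rY] of [f (pi x)]; this costs [rY + 2 * dist], and the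
    displacement of [f \o pi] over the ball costs [2 * kappa * (eX + rX)]. *)
Lemma nearest_vertex_map_eball (n m : nat) (X : set 'rV[R]_n)
    (Y : set 'rV[R]_m) (f : 'rV[R]_n -> 'rV[R]_m) (kappa rX eX rY eY dist : R)
    (X' : {fset 'rV[R]_n}) (Y' : {fset 'rV[R]_m}) (f' : X' -> 'rV[R]_m)
    (phi : {ffun X' -> Y'}) (x : X') (w : 'rV[R]_n) :
  compact X -> f @` X `<=` Y -> 0 <= kappa -> lipschitz_bound X f kappa ->
  dist < ((eY - rY) - 2 * kappa * (eX + rX)) / 2 ->
  tub rX X (val x) -> (forall p, Y p -> exists y : Y', enorm (p - val y) < rY) ->
  enorm (f' x - f (nearest_proj X (val x))) <= dist ->
  is_nearest_vertex_map f' phi -> eball (val x) eX w ->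
  eball (val (phi x)) eY (f (nearest_proj X w)).
Proof.
move=> cX fXY kappa0 f_lip dist_lt xX Y'_dense f'_dist phiP xw.
have X0 : X !=set0 by case: xX => p Xp _; exists p.
have [Xpx _] := nearest_projP (val x) cX X0.
have [Xpw _] := nearest_projP w cX X0.
have [|y fy] := Y'_dense (f (nearest_proj X (val x))).
  by apply: fXY; exists (nearest_proj X (val x)).
have := forallP (forallP phiP x) y => phi_min.
have f_moves : enorm (f (nearest_proj X w) - f (nearest_proj X (val x)))
    <= kappa * (2 * (eX + rX)).
  apply: le_trans (f_lip _ _ Xpw Xpx) _; rewrite enorm_sym.
  by apply: ler_wpM2l => //; exact: nearest_proj_eball.
have := enorm_dist_triangle (f (nearest_proj X (val x))) (f' x) (val y).
have := enorm_dist_triangle (f (nearest_proj X (val x)))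
  (f (nearest_proj X w)) (val (phi x)).
have := enorm_dist_triangle (f' x) (f (nearest_proj X (val x))) (val (phi x)).
have := enorm_sym (f' x) (f (nearest_proj X (val x))).
rewrite /eball /= => h1 h2 h3 h4.
lra.
Qed.

Lemma nearest_vertex_rule_reconstructs (n m : nat) (X : set 'rV[R]_n)
    (Y : set 'rV[R]_m) (f : 'rV[R]_n -> 'rV[R]_m) (tau kappa rX eX rY eY dist : R)
    (X' : {fset 'rV[R]_n}) (Y' : {fset 'rV[R]_m}) (f' : X' -> 'rV[R]_m) :
  compact X -> is_tau X tau -> eX + rX <= tau -> rY <= eY ->
  f @` X `<=` Y -> 0 <= kappa -> lipschitz_bound X f kappa ->
  dist < ((eY - rY) - 2 * kappa * (eX + rX)) / 2 ->
  (forall x : X', tub rX X (val x)) ->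
  (forall p, Y p -> exists y : Y', enorm (p - val y) < rY) ->
  (forall x, enorm (f' x - f (nearest_proj X (val x))) <= dist) ->
  exists2 phi : simplicial_map eX X' eY Y',
    @nearest_vertex_rule n m X' Y' eX eY kappa f' = Some phi &
    simplicial_reconstruction X Y f phi.
Proof.
move=> cX tauX eX_tau rY_eY fXY kappa0 f_lip dist_lt X'X Y'_dense f'_dist.
have X_nonempty (x : X') : X !=set0 by have [p Xp _] := X'X x; exists p.
have [psi psiP] : exists phi : {ffun X' -> Y'}, is_nearest_vertex_map f' phi.
  apply: nearest_vertex_map_exists => x.
  have [Xp _] := nearest_projP (val x) cX (X_nonempty x).
  by have [|y _] := Y'_dense (f (nearest_proj X (val x)));
    [apply: fXY; exists (nearest_proj X (val x))|constructor].
rewrite /nearest_vertex_rule; case: pickP => [phi phiP|/(_ psi)]; last first.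
  by rewrite psiP.
have phi_eball (x : X') w : eball (val x) eX w ->
    eball (val (phi x)) eY (f (nearest_proj X w)).
  exact: (nearest_vertex_map_eball cX fXY kappa0 f_lip dist_lt (X'X x)
    Y'_dense (f'_dist x) phiP).
(* The image of a common point of the balls of a simplex is a common point of
   the balls of the image simplex. *)
case: pselect => [phi_simplicial|[] s [s0 [w sw]]]; last first.
  split.
    have /set0Pn[x xs] := s0.
    by apply/set0Pn; exists (phi x); apply/imsetP; exists x.
  exists (f (nearest_proj X w)) => y /= /imsetP[x xs ->].
  exact/phi_eball/sw.
exists (SimplicialMap phi_simplicial) => //; split.
- move=> w [x /= xX' xw].
  have wX := tub_eball (X'X [` xX']%fset) xw.
  have X0 := X_nonempty [` xX']%fset.
  have wP := nearest_projP w cX X0.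
  exists (nearest_proj X w); split=> // z zP.
  apply: is_nearest_unique tauX wP zP _.
  by have := nearest_proj_dist cX wX; lra.
- move=> p /Y'_dense[y py]; exists (val y); first exact: valP.
  exact: lt_le_trans py rY_eY.
- move=> s _ _ [w [x /= xs xw] <-].
  exists (phi x) => /=; last exact: phi_eball.
  by apply/imsetP; exists x.
Qed.

End Reconstruction.

(** * Null sets and ball masses of conditioned measures *)

Section BorelMeasure.
Variables (R : realType) (n : nat) (mu : probability (borelRn R n) R).

Lemma measurable_open (U : set 'rV[R]_n) :
  open U -> measurable (U : set (borelRn R n)).
Proof. by move=> oU; exact: sub_sigma_algebra. Qed.

Lemma measurable_closed (C : set 'rV[R]_n) :
  closed C -> measurable (C : set (borelRn R n)).
Proof.
move=> cC; rewrite -(setCK C); apply: measurableC; apply: measurable_open.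
exact: closed_openC.
Qed.

Lemma compact_locally_null (K : set 'rV[R]_n) : closed K -> compact K ->
  (forall x, K x -> exists U, [/\ open U, U x & mu U = 0%E]) -> mu K = 0%E.
Proof.
move=> clK cK K_null.
have /choice[U UP] : forall x, exists U : set 'rV[R]_n,
    K x -> [/\ open U, U x & mu U = 0%E].
  move=> x; have [/K_null[U UP]|nKx] := pselect (K x); first by exists U.
  by exists set0 => /nKx.
have U_open x : K x -> open (U x) by move=> /UP[].
have K_cover : K `<=` cover K U.
  by move=> x Kx; exists x => //; have [] := UP x Kx.
have := cK; rewrite compact_cover => /(_ _ K U U_open K_cover)[D DK KD].
have U_null x : [set` D] x -> [/\ open (U x), U x x & mu (U x) = 0%E].
  by move=> /DK/set_mem/UP.
apply/eqP; rewrite eq_le measure_ge0 andbT.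
have := @content_sub_fsum _ _ _ mu _ [set` D] K U (finite_fset D).
rewrite fsbig1; last by move=> x /U_null[].
apply => //; last exact: measurable_closed.
by move=> x /U_null[oU _ _]; exact: measurable_open.
Qed.

(** A closed set is the union of its compact intersections with the balls of
    integer radius, and countable unions preserve null sets. *)
Lemma closed_locally_null (C : set 'rV[R]_n) : closed C ->
  (forall x, C x -> exists U, [/\ open U, U x & mu U = 0%E]) -> mu C = 0%E.
Proof.
move=> clC C_null.
pose B (k : nat) := [set x : 'rV[R]_n | `|x| <= k%:R].
have clB k : closed (B k).
  by apply: (@preimage_closed _ _ (@Num.norm R 'rV[R]_n) [set t : R | t <= k%:R]);
    [move=> x _; exact: norm_continuous|exact: closed_le].
have clCB k : closed (C `&` B k) by exact: closedI.
have CB_null k : mu (C `&` B k) = 0%E.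
  apply: compact_locally_null => //; last by move=> x [/C_null].
  apply: bounded_closed_compact => //; exists k%:R; split=> // M kM x [_ xk].
  exact/(le_trans xk)/ltW.
have CE : C = \bigcup_k (C `&` B k).
  apply/seteqP; split => [x Cx|x [k _ []//]].
  exists (Num.truncn `|x|).+1 => //; split => //.
  exact/ltW/truncnS_gt.
apply: measure_negligible; first exact: measurable_closed.
rewrite CE; apply: negligible_bigcup => k.
by apply/negligibleP; [exact: measurable_closed|exact: CB_null].
Qed.

(** The support is only known through its points: that it carries the whole mass
    is due to the sigma-compactness of the closed complement of the tube. *)
Lemma conditioned_tub (X : set 'rV[R]_n) r :
  conditioned X r mu -> mu (~` tub r X) = 0%E.
Proof.
move=> [supp _]; apply: closed_locally_null; first exact/open_closedC/open_tub.
move=> x /(contra_not (supp x)) /existsNP[U /not_implyP[oU /not_implyP[Ux]]].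
by move=> /negP; rewrite lt0e negb_and negbK measure_ge0 orbF => /eqP ?; exists U.
Qed.

Lemma Omega_bounds (Y : set 'rV[R]_n) r : 0 < r -> Y !=set0 ->
  conditioned Y r mu ->
  exists2 q, Omega mu Y (r / 2) = q%:E & 0 < q <= 1.
Proof.
move=> r0 [y Yy] [_ /(_ (r / 2))].
have -> : 0 < r / 2 by lra.
have -> : r / 2 < r by lra.
move=> /(_ erefl erefl) Om0.
have Om1 : (Omega mu Y (r / 2) <= 1)%E.
  have := probability_le1 mu (measurable_open (@open_eball _ _ y (r / 2))).
  apply: le_trans.
  by apply: ereal_inf_lbound; exists y.
move: Om0 Om1; case: Omega => // q; rewrite lte_fin lee_fin => q0 q1.
by exists q => //; rewrite q0.
Qed.

Lemma Omega_le (Y : set 'rV[R]_n) s y : Y y -> (Omega mu Y s <= mu (eball y s))%E.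
Proof. by move=> Yy; apply: ereal_inf_lbound; exists y. Qed.

End BorelMeasure.

(** * Covering by balls and missing a ball *)

Section Sampling.
Variable R : realType.

Lemma compact_covered_by n (Y : set 'rV[R]_n) (nu : R) : compact Y -> 0 < nu ->
  Defs.covered_by Y nu (covering_number Y nu).
Proof.
move=> cY nu0.
have exq : exists q, `[< Defs.covered_by Y nu q >].
  have balls_open y : Y y -> open (eball y nu) by move=> _; exact: open_eball.
  have Y_cover : Y `<=` cover Y (fun y => eball y nu).
    move=> y Yy; exists y => //; rewrite /eball /= subrr /enorm /edot.
    by rewrite big1 ?sqrtr0// => i _; rewrite mxE mul0r.
  have := cY; rewrite compact_cover => /(_ _ Y _ balls_open Y_cover)[D DY YD].
  exists #|` D|%fset; apply/asboolP; exists D; split=> //.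
  by move=> y /DY/set_mem.
rewrite /covering_number; case: pselect => // {}exq.
by case: ex_minnP => q /asboolP.
Qed.

(** The threshold [gamma] on the sample size is chosen for this union bound, with
    [L] the number of balls and [q] a lower bound on their masses. *)
Lemma gamma_tail (L q delta M : R) : 0 < L -> 0 < q -> 0 < delta ->
  q^-1 * (ln L + ln (1 / delta)) < M -> L * expR (- (q * M)) < delta.
Proof.
move=> L0 q0 delta0; rewrite mulrC ltr_pdivrMr // => M_gt.
have <- : expR (ln delta) = delta by rewrite lnK.
rewrite -{1}(lnK L0) -expRD ltr_expR.
move: M_gt; rewrite div1r lnV //; lra.
Qed.

Section Independence.
Variables (n m : nat) (d : measure_display) (T : measurableType d).
Variables (P : probability T R) (mu : probability (borelRn R n) R).
Variables (nu : probability (borelRn R m) R) (N M : nat).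
Variables (xi : 'I_N -> {RV P >-> borelRn R n}).
Variables (eta : 'I_M -> {RV P >-> borelRn R m}).
Hypothesis iid : independent_iid_samples mu nu xi eta.

Definition all_miss (B : set 'rV[R]_m) : set T :=
  \bigcap_(j : 'I_M) (eta j @^-1` (~` B)).

(** The probability is [(1 - nu B) ^+ M] by independence, and
    [1 - q <= expR (- q)]. *)
Lemma all_miss_le (B : set 'rV[R]_m) q : measurable (B : set (borelRn R m)) ->
  (q%:E <= nu B)%E -> (P (all_miss B) <= (expR (- (q * M%:R)))%:E)%E.
Proof.
move=> mB qB; have [_ eta_nu indep] := iid.
(* Independence is stated for both samples together: the events attached to the
   first one are taken to be the sure event. *)
pose A (k : 'I_N + 'I_M) : set T :=
  if k is inr j then eta j @^-1` (~` B) else setT.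
have mCB : measurable (~` B : set (borelRn R m)) by exact: measurableC.
have -> : all_miss B = \bigcap_k A k.
  apply/seteqP; split => w h; first by case=> // j _; exact: h.
  by move=> j _; exact: (h (inr j)).
rewrite indep; last first.
  case=> [i|j]; first by exists setT; [exact: measurableT|rewrite setTI].
  by exists (~` B) => //; rewrite setTI.
rewrite big_sumType /= big1 ?mul1e; last by move=> i _; exact: probability_setT.
have Bfin : nu B \is a fin_num by exact: fin_num_measure.
have missE j : P (eta j @^-1` (~` B)) = (1 - fine (nu B))%:E.
  have := eta_nu j _ mCB; rewrite /distribution /pushforward => ->.
  by rewrite probability_setC // EFinB fineK.
rewrite (eq_bigr _ (fun j _ => missE j)) prodEFin lee_fin prodr_const card_ord.
have Ble1 : 0 <= 1 - fine (nu B).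
  by rewrite subr_ge0 -lee_fin fineK // probability_le1.
rewrite mulrC -mulrN expRM_natl; apply: lerXn2r; rewrite ?nnegrE ?expR_ge0 //.
apply: (le_trans _ (expR_ge1Dx _)); rewrite lerD2l lerN2.
by rewrite -lee_fin fineK.
Qed.

Lemma xi_null i (A : set 'rV[R]_n) : measurable (A : set (borelRn R n)) ->
  mu A = 0%E -> P (xi i @^-1` A) = 0%E.
Proof. by move=> mA <-; have [xi_mu _ _] := iid; exact: (xi_mu i A mA). Qed.

End Independence.
End Sampling.

(** * The favourable event *)

Section GoodEvent.
Variables (R : realType) (n m : nat) (d : measure_display) (T : measurableType d).
Variables (P : probability T R) (mu : probability (borelRn R n) R).
Variables (nu : probability (borelRn R m) R) (N M : nat).
Variables (xi : 'I_N -> {RV P >-> borelRn R n}).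
Variables (eta : 'I_M -> {RV P >-> borelRn R m}).

(** Otherwise the tube would be empty and its null complement the whole space. *)
Lemma conditioned_nonempty k (lambda : probability (borelRn R k) R)
  (Z : set 'rV[R]_k) r : conditioned Z r lambda -> Z !=set0.
Proof.
move=> /conditioned_tub; have [-> | /set0P//] := eqVneq Z set0.
have -> : ~` tub r set0 = [set: 'rV[R]_k].
  by apply/seteqP; split => // x _ [p].
by move/eqP; rewrite probability_setT gt_eqF.
Qed.

(** The centers of an optimal cover of [Y] by balls of radius [rY / 2] serve as a
    net: once each of these balls contains a sample point, every point of [Y] is
    within [rY / 2 + rY / 2] of the sample. *)
Lemma good_event (X : set 'rV[R]_n) (Y : set 'rV[R]_m) (rX rY delta : R) :
  independent_iid_samples mu nu xi eta ->
  conditioned X rX mu -> compact Y -> 0 < rY -> conditioned Y rY nu ->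
  0 < delta -> gamma Y rY nu delta < M%:R ->
  exists E : set T, [/\ measurable E, ((1 - delta)%:E < P E)%E &
    forall w, E w -> (forall i, tub rX X (xi i w)) /\
      forall p, Y p -> exists j, enorm (p - eta j w) < rY].
Proof.
move=> iid condX cY rY0 condY delta0 M_gt.
have Y0 := conditioned_nonempty condY.
have r20 : 0 < rY / 2 by rewrite divr_gt0.
have [S [Scard SY Scover]] := compact_covered_by cY r20.
set L := covering_number Y (rY / 2) in Scard.
have [q qE /andP[q0 q1]] := Omega_bounds rY0 Y0 condY.
have L0 : 0 < L%:R :> R.
  rewrite ltr0n -Scard cardfs_gt0; have [y Yy] := Y0.
  by have [s /= sS _] := Scover y Yy; apply/fset0Pn; exists s.
have tail : L%:R * expR (- (q * M%:R)) < delta.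
  by apply: gamma_tail => //; move: M_gt; rewrite /gamma qE.
have mB s : measurable (eball s (rY / 2) : set (borelRn R m)).
  by apply: measurable_open; exact: open_eball.
have mtub : measurable (~` tub rX X : set (borelRn R n)).
  by apply: measurableC; apply: measurable_open; exact: open_tub.
pose stray := \bigcup_(i : 'I_N) (xi i @^-1` (~` tub rX X)).
pose miss s := all_miss eta (eball s (rY / 2)).
have m_stray_i i : measurable (xi i @^-1` (~` tub rX X)).
  by rewrite -[X in measurable X]setTI; exact: measurable_funP.
have m_stray : measurable stray.
  by apply: fin_bigcup_measurable => [|i _];
    [exact: finite_finset|exact: m_stray_i].
have m_miss s : measurable (miss s).
  apply: fin_bigcap_measurable => [|j _]; first exact: finite_finset.
  rewrite -[X in measurable X]setTI; apply: measurable_funP => //.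
  exact: measurableC.
have m_misses : measurable (\bigcup_(s in [set` S]) miss s).
  by apply: fin_bigcup_measurable => // s _; exact: m_miss.
have P_stray : P stray = 0%E.
  apply/eqP; rewrite eq_le measure_ge0 andbT.
  have := @content_sub_fsum _ _ _ P _ [set: 'I_N] stray
    (fun i => xi i @^-1` (~` tub rX X)) (@finite_finset _ _).
  rewrite fsbig1; last first.
    by move=> i _; apply: (xi_null iid) => //; exact: conditioned_tub.
  by apply.
have P_misses : (P (\bigcup_(s in [set` S]) miss s) < delta%:E)%E.
  apply: (@le_lt_trans _ _ (\sum_(s \in [set` S]) P (miss s))%E).
    by apply: content_sub_fsum => // s _; exact: m_miss.
  rewrite fsbig_finite // set_fsetK.
  apply: (@le_lt_trans _ _ (\sum_(s <- S) (expR (- (q * M%:R)))%:E)%E).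
    rewrite big_seq [leRHS]big_seq; apply: lee_sum => s sS.
    apply: (all_miss_le iid (mB s)); rewrite -qE; apply: Omega_le.
    exact: SY.
  rewrite sumEFin lte_fin big_const_seq count_predT iter_addr_0 Scard.
  by rewrite -[_ *+ L]mulr_natl.
exists (~` (stray `|` \bigcup_(s in [set` S]) miss s)); split.
- exact/measurableC/measurableU.
- rewrite probability_setC; last exact: measurableU.
  have bad_lt : (P (stray `|` \bigcup_(s in [set` S]) miss s) < delta%:E)%E.
    by rewrite setUC measureU0.
  have bad_fin : P (stray `|` \bigcup_(s in [set` S]) miss s) \is a fin_num.
    by apply: fin_num_measure; exact: measurableU.
  move: bad_lt; rewrite -(fineK bad_fin) lte_fin -EFinB lte_fin; lra.
- move=> w /not_orP[w_stray w_miss]; split.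
    move=> i; apply: contra_notP w_stray => wi; by exists i.
  move=> p /Scover[s /= sS ps].
  have : ~ miss s w by apply: contra_not w_miss => h; exists s.
  move=> /existsNP[j /not_implyP[_ /contrapT etaj]]; exists j.
  apply: le_lt_trans (enorm_dist_triangle s _ _) _.
  rewrite (splitr rY); apply: ltrD => //.
  by rewrite enorm_sym.
Qed.

End GoodEvent.

(** * The theorem *)

Theorem theorem5p6 (R : realType) :
  exists Rule : reconstruction_rule R,
  forall (n m : nat) (X : set 'rV[R]_n) (Y : set 'rV[R]_m) (tauX tauY : R)
    (deltaX deltaY : R) (f : 'rV[R]_n -> 'rV[R]_m) (kappa : R) (rX rY : R)
    (muX : probability (borelRn R n) R) (muY : probability (borelRn R m) R)
    (eX eY : R)
    (d : measure_display) (T : measurableType d) (P : probability T R)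
    (N M : nat) (xi : 'I_N -> {RV P >-> borelRn R n})
    (eta : 'I_M -> {RV P >-> borelRn R m}) (dist : R),
  compact_submanifold X -> compact_submanifold Y ->
  is_tau X tauX -> is_tau Y tauY ->
  0 < deltaX <= 1 -> 0 < deltaY <= 1 ->
  f @` X `<=` Y -> 0 <= kappa -> lipschitz_bound X f kappa ->
  4 * kappa * tauX < (Num.sqrt 2 - 1) * tauY ->
  0 < rX < (3 - Num.sqrt 8) * tauX ->
  0 < rY < (3 - Num.sqrt 8) * tauY ->
  conditioned X rX muX -> conditioned Y rY muY ->
  Gamma_minus tauX rX < eX < Gamma_plus tauX rX ->
  Gamma_minus tauY rY < eY < Gamma_plus tauY rY ->
  4 * kappa * (eX + rX) < eY - rY ->
  independent_iid_samples muX muY xi eta ->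
  gamma X rX muX deltaX < N%:R ->
  gamma Y rY muY deltaY < M%:R ->
  0 < dist -> dist < ((eY - rY) - 2 * kappa * (eX + rX)) / 2 ->
  exists E : set T,
    [/\ measurable E,
        (((1 - deltaX) * (1 - deltaY))%:E < P E)%E &
        forall w, E w ->
        forall f' : sample_set xi w -> 'rV[R]_m,
        (forall x, enorm (f' x - f (nearest_proj X (val x))) <= dist) ->
        exists2 phi : simplicial_map eX (sample_set xi w) eY (sample_set eta w),
          Rule n m _ _ eX eY kappa f' = Some phi &
          simplicial_reconstruction X Y f phi].
Proof.
exists (@nearest_vertex_rule R) => n m X Y tauX tauY deltaX deltaY f kappa rX rY
  muX muY eX eY d T P N M xi eta dist [cX _] [cY _] X_tau _ /andP[dX0 dX1]
  /andP[dY0 dY1] fXY kappa0 f_lip _ rX_bound rY_bound condX condY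
  /andP[eX_gt eX_lt] _ eps_gap iid _ M_gt dist0 dist_lt.
have rX0 : 0 < rX by case/andP: rX_bound.
have rY0 : 0 < rY by case/andP: rY_bound.
have [E [mE PE goodE]] := good_event iid condX cY rY0 condY dY0 M_gt.
exists E; split=> //.
  by apply: le_lt_trans PE; rewrite lee_fin ler_piMl; lra.
move=> w /goodE[xi_tub eta_dense] f' f'_dist.
have eX0 : 0 < eX by apply: le_lt_trans eX_gt; exact: Gamma_minus_ge0.
have eX_tau : eX + rX <= tauX by have := Gamma_plus_lt rX_bound; lra.
have rY_eY : rY <= eY.
  have : 0 <= 4 * kappa * (eX + rX) by rewrite !mulr_ge0 //; lra.
  lra.
apply: (nearest_vertex_rule_reconstructs cX X_tau eX_tau rY_eY fXY kappa0 f_lip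
  dist_lt _ _ f'_dist).
- by move=> x; have /imfsetP[/= i _ ->] := valP x; exact: xi_tub.
- move=> p /eta_dense[j pj].
  have etaj : (eta j w : 'rV[R]_m) \in sample_set eta w.
    by apply/imfsetP; exists j.
  by exists [` etaj]%fset.
Qed.
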